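(* Fix $d\ge1$. Let $N_i$ denote the $i$-th smallest prime number. For each $i$, let $a_i\in\{1,\dots,N_i-1\}$ be a maximizer over $a\in\{1,\dots,N_i-1\}$ of the product $\lambda_1(\Lambda_{N_i,a})\,\lambda_1(\Lambda_{N_i,a}^{\perp})$, where $\Lambda_{N,a}$ is the lattice of the Korobov lattice point set with $N$ points and parameter $a$. Then the family of Korobov lattice point sets $(P_{N_i,z(a_i)})_{i\in\mathbb{N}}$ with $z(a)=(1,a,a^2,\dots,a^{d-1}) \bmod N_i$ is a quasi-uniform family of point sets over $[0,1]^d$.
   Context: For $N\in\mathbb{N}$ and $z\in\mathbb{Z}^d$ with $\gcd(N,z_1,\dots,z_d)=1$, the rank-1 lattice point set is $P_{N,z}=\{(\{nz_1/N\},\dots,\{nz_d/N\}) : n=0,\dots,N-1\}$, $\{x\}=x-\lfloor x\rfloor$; it equals $\Lambda\cap[0,1)^d$ for $\Lambda=\frac1N z\mathbb{Z}+\mathbb{Z}^d$. The Korobov lattice point set with parameter $a$ uses $z=(1,a,\dots,a^{d-1}) \bmod N$, and $\Lambda_{N,a}=\frac1N z\mathbb{Z}+\mathbb{Z}^d$. The dual lattice is $\Lambda^{\perp}=\{y\in\mathbb{R}^d : x\cdot y\in\mathbb{Z}\ \forall x\in\Lambda\}$; $\lambda_1(\cdot)$ denotes the Euclidean length of a shortest non-zero lattice vector. For a finite point set $P\subset[0,1]^d$ with at least two points: $h(P)=\sup_{x\in[0,1]^d}\min_{y\in P}\|x-y\|_2$, $q(P)=\frac12\min_{x\ne y\in P}\|x-y\|_2$,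 $\rho(P)=h(P)/q(P)$. A family $(P_{N_i})_{i}$ with $N_i=|P_{N_i}|$ is a quasi-uniform family if there is $c>1$ with $N_i<N_{i+1}\le cN_i$ for all $i$ and a constant $C_d$ independent of $i$ with $\rho(P_{N_i})\le C_d$ for all $i$. *)

(* Defs.v *)
From HB Require Import structures.
From mathcomp Require Import all_boot all_order all_algebra.
From mathcomp Require Import boolp classical_sets reals.
Set Implicit Arguments. Unset Strict Implicit. Unset Printing Implicit Defensive.
Import Order.TTheory GRing.Theory Num.Theory.
Local Open Scope classical_set_scope.
Local Open Scope ring_scope.

Lemma exists_prime_above (p : nat) : exists q, ((p < q)%N && prime q).
Proof. case: (prime_above p) => q H1 H2; exists q; by rewrite H1 H2. Qed.

Definition next_prime (p : nat) : nat := ex_minn (exists_prime_above p).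

(* nth_prime i = the (i+1)-th smallest prime (0-indexed: nth_prime 0 = 2) *)
Fixpoint nth_prime (i : nat) : nat :=
  match i with
  | 0 => 2
  | i'.+1 => next_prime (nth_prime i')
  end.

Section Geometry.
Variables (R : realType) (d : nat).

Notation pt := 'rV[R]_d.

Definition frac (x : R) : R := x - (Num.floor x)%:~R.

Definition enorm (x : pt) : R := Num.sqrt (\sum_(j < d) (x 0 j) ^+ 2).
Definition edist (x y : pt) : R := enorm (x - y).
Definition dotp (x y : pt) : R := \sum_(j < d) x 0 j * y 0 j.

Definition unit_cube : set pt := [set x | forall j, 0 <= x 0 j <= 1].

(* finite point sets are given as sequences; the set is {y | y \in P} *)
Definition card_pts (P : seq pt) : nat := size (undup P).

Definition mindist (x : pt) (P : seq pt) : R := inf [set edist x y | y in [set y | y \in P]].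

Definition fill_dist (P : seq pt) : R := sup [set mindist x P | x in unit_cube].
Definition sep_rad (P : seq pt) : R :=
  inf [set r | exists x y, [/\ x \in P, y \in P, x != y & r = edist x y]] / 2.
Definition mesh_ratio (P : seq pt) : R := fill_dist P / sep_rad P.

Definition rank1_pts (N : nat) (z : 'I_d -> nat) : seq pt :=
  [seq \row_j frac (n%:R * (z j)%:R / N%:R) | n <- iota 0 N].

Definition rank1_lattice (N : nat) (z : 'I_d -> nat) : set pt :=
  [set v | exists (k : int) (m : 'I_d -> int),
       forall j, v 0 j = k%:~R * (z j)%:R / N%:R + (m j)%:~R].

Definition dual_lattice (L : set pt) : set pt :=
  [set y | forall x, L x -> exists t : int, dotp x y = t%:~R].

Definition lambda1 (L : set pt) : R := inf [set enorm v | v in [set v | L v /\ v != 0]].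

Definition korobov_z (N a : nat) : 'I_d -> nat := fun j => (a ^ j %% N)%N.
Definition korobov_lattice (N a : nat) : set pt := rank1_lattice N (korobov_z N a).
Definition korobov_pts (N a : nat) : seq pt := rank1_pts N (korobov_z N a).

Definition quasi_uniform (P : nat -> seq pt) : Prop :=
  (forall i, (2 <= card_pts (P i))%N) /\
  (exists c : R, 1 < c /\
     forall i, (card_pts (P i) < card_pts (P i.+1))%N /\
               (card_pts (P i.+1))%:R <= c * (card_pts (P i))%:R) /\
  (exists C : R, forall i, mesh_ratio (P i) <= C).

End Geometry.

(* Main.v *)
Require Import Defs.
From HB Require Import structures.
From mathcomp Require Import all_boot all_order all_algebra.
From mathcomp Require Import boolp classical_sets reals.
From mathcomp Require Import zify ring lra.
Set Implicit Arguments. Unset Strict Implicit. Unset Printing Implicit Defensive.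
Import Order.TTheory GRing.Theory Num.Theory.

(** The ratio of consecutive primes is bounded by Erdos' argument: without primes in
(n, 8n], the binomial coefficient C(8n, 4n) >= 2^(4n) would have too few prime factors.

For the mesh ratio, let L be the lattice, M its dual, and N a large prime.
- Existence of a good parameter: a nonzero integer vector y with entries bounded by r
  lies in M for at most d - 1 parameters b, the roots of sum_j y_j X^j modulo N. A union
  bound over y gives b with lambda1(M) >= r, where r is of order N^(1/d). A vector w / N
  of L, with w integral, then cannot be short: by pigeonhole some small integer vector
  would be exactly orthogonal to w, hence in M. So lambda1(L) lambda1(M) >= c, where c
  depends on d only, and a maximizer satisfies this as well.
- Consequence for every such parameter: lambda1(M) = O(N^(1/d)) by pigeonhole, so
  lambda1(L) >= c' N^(-1/d). If the vectors of L of size K N^(-1/d) all lay in one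
  hyperplane, pigeonhole would give two lattice points at distance less than lambda1(L),
  for K large. Hence they contain a basis of R^d, and rounding coordinates in this basis
  bounds the fill distance by O(N^(-1/d)), that is, by O(lambda1(L)).
The finitely many small primes only change the constants. *)

(** * Gaps between primes *)

Lemma expn2_le_central_bin m : 2 ^ m <= 'C(m.*2, m).
Proof.
elim: m => [|m IH] //.
rewrite doubleS binS.
have -> : 'C((m.*2).+1, m.+1) = 'C((m.*2).+1, m).
  rewrite -bin_sub; last by lia.
  by congr ('C(_, _)); lia.
by rewrite addnn -mul2n expnS leq_mul2l /= (leq_trans IH) // leq_bin2l.
Qed.

(** The two equal middle coefficients both occur in the expansion of [2 ^ (2m+1)], so each is at
    most half of it. *)
Lemma odd_central_bin_le m : 'C(m.*2.+1, m) <= 4 ^ m.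
Proof.
have H : 'C(m.*2.+1, m) + 'C(m.*2.+1, m.+1) <= 2 ^ m.*2.+1.
  have := expnDn 1 1 m.*2.+1; rewrite addn1 => ->.
  under eq_bigr => i _ do rewrite !exp1n !muln1.
  have h1 : m < m.*2.+2 by lia.
  have h2 : m.+1 < m.*2.+2 by lia.
  rewrite (bigD1 (Ordinal h1)) //= (bigD1 (Ordinal h2)) /=; first by lia.
  by rewrite -val_eqE /=; lia.
have E : 'C(m.*2.+1, m.+1) = 'C(m.*2.+1, m).
  rewrite -bin_sub; last by lia.
  by congr ('C(_, _)); lia.
rewrite E addnn -mul2n expnS leq_mul2l /= in H.
by rewrite -[4]/(2 ^ 2) -expnM mul2n.
Qed.

Lemma prime_prod_dvd a b M :
  (forall p, prime p -> a <= p < b -> p %| M) ->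
  \prod_(a <= p < b | prime p) p %| M.
Proof.
elim: b => [|b IH] H; first by rewrite big_geq.
case: (leqP a b) => ab; last by rewrite big_geq.
have {}IH : \prod_(a <= p < b | prime p) p %| M.
  by apply: IH => p pp /andP[h1 h2]; apply: H => //; rewrite h1 ltnW.
rewrite big_mkcond big_nat_recr //= -big_mkcond; case: ifP => pb; last by rewrite muln1.
rewrite Gauss_dvd ?IH /= ?H ?ab ?ltnSn //.
rewrite coprime_sym big_nat_cond.
elim/big_ind: _ => [|x y|p /andP[/andP[_ pb'] pp]]; first exact: coprimen1.
  by move=> hx hy; rewrite coprimeMr hx.
by rewrite prime_coprime // dvdn_prime2 // neq_ltn pb' orbT.
Qed.

Lemma prime_dvdn_fact p m : prime p -> p %| m`! -> p <= m.
Proof.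
move=> pp; elim: m => [|m IH]; first by rewrite fact0 dvdn1 => /eqP E; rewrite E in pp.
rewrite factS Euclid_dvdM // => /orP[/dvdn_leq->//|/IH]; exact: leqW.
Qed.

(** Strong induction. An even [n > 2] is not prime. If [n = 2m+1], the primes in [[m+2, 2m+1]] all
    divide ['C(2m+1, m) <= 4 ^ m], and the others contribute at most [4 ^ (m+1)] by induction. *)
Lemma primorial_le n : \prod_(0 <= p < n.+1 | prime p) p <= 4 ^ n.
Proof.
elim/ltn_ind: n => n IH.
have rec k : \prod_(0 <= p < k.+1 | prime p) p =
    \prod_(0 <= p < k | prime p) p * (if prime k then k else 1).
  by rewrite big_mkcond big_nat_recr //= -big_mkcond.
case: (leqP n 2) => [|n2].
  case: n IH => [|[|[|n]]] IH //; rewrite !rec /= big_geq //.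
have [n_odd|n_even] := boolP (odd n); last first.
  have -> : \prod_(0 <= p < n.+1 | prime p) p = \prod_(0 <= p < n | prime p) p.
    rewrite rec; case: ifP => [pn|_]; last by rewrite muln1.
    by case: (even_prime pn) n_even n2 => [->|->].
  case: n n2 IH {n_even} => // n _ IH; apply: leq_trans (IH n _) _ => //.
  by rewrite leq_exp2l.
have en : n = n./2.*2.+1 by rewrite -[LHS]odd_double_half n_odd.
set m := n./2 in en.
rewrite (@big_cat_nat _ _ _ m.+2) /=; try lia.
apply: leq_trans (_ : 4 ^ m.+1 * 4 ^ m <= _); last first.
  by rewrite -expnD leq_exp2l // en; lia.
apply: leq_mul; first by apply: IH; lia.
apply: leq_trans (odd_central_bin_le m).
apply: dvdn_leq; first by rewrite bin_gt0; lia.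
apply: prime_prod_dvd => p pp /andP[h1 h2].
have h : p %| 'C(m.*2.+1, m) * (m`! * (m.*2.+1 - m)`!).
  by rewrite bin_fact; [apply: dvdn_fact; rewrite prime_gt0 //=|]; lia.
move: h; rewrite !Euclid_dvdM // => /or3P[//|/(prime_dvdn_fact pp)|/(prime_dvdn_fact pp)]; lia.
Qed.

(** By Legendre's formula the exponent is the sum over [k] of [2m %/ p^k - 2 (m %/ p^k)]. Each term
    is at most 1, and it vanishes once [p^k > 2m]. *)
Lemma pfactor_central_bin_le p m :
  prime p -> 0 < m -> p ^ logn p 'C(m.*2, m) <= m.*2.
Proof.
move=> pp m0; have p1 := prime_gt1 pp.
apply: leq_trans (trunc_logP p1 _); last by lia.
rewrite leq_exp2l //; set t := trunc_log p m.*2.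
have E : logn p (m.*2)`! = logn p 'C(m.*2, m) + (logn p m`!).*2.
  have := @bin_fact m.*2 m; rewrite (_ : m.*2 - m = m); last by lia.
  move=> <-; last by lia.
  by rewrite !lognM ?muln_gt0 ?fact_gt0 ?bin_gt0 ?addnn //; lia.
have Em : logn p m`! = \sum_(1 <= k < m.*2.+1) m %/ p ^ k.
  rewrite logn_fact // [RHS](@big_cat_nat _ _ _ m.+1) //=; last by lia.
  rewrite [X in _ = _ + X]big1_seq ?addn0 // => k.
  rewrite mem_index_iota /= => /andP[k1 k2].
  by rewrite divn_small // (leq_trans k1) // ltnW // ltn_expl.
have le1 : \sum_(1 <= k < m.*2.+1) m.*2 %/ p ^ k
    <= \sum_(1 <= k < m.*2.+1) ((m %/ p ^ k).*2 + (k < t.+1)).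
  apply: leq_sum => k _; have q0 : 0 < p ^ k by rewrite expn_gt0 prime_gt0.
  case: ltnP => kt /=.
    rewrite addn1 -ltnS ltn_divLR //.
    have := ltn_ceil m q0; rewrite -addnn; nia.
  rewrite divn_small // (leq_trans (trunc_log_ltn _ p1)) // leq_exp2l //.
rewrite big_split /= -(big_morph _ doubleD double0) in le1.
rewrite -Em -logn_fact // E addnC leq_add2l in le1.
apply: leq_trans le1 _.
rewrite -big_mkcond /= sum1_count -size_filter.
apply: leq_trans (_ : size (index_iota 1 t.+1) <= t); last by rewrite size_iota subn1.
apply: uniq_leq_size => [|k]; first by rewrite filter_uniq // iota_uniq.
by rewrite mem_filter !mem_index_iota => /andP[-> /andP[->]].
Qed.

Lemma prime_dvd_central_bin_le p m : prime p -> p %| 'C(m.*2, m) -> p <= m.*2.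
Proof.
move=> pp pd; apply: (prime_dvdn_fact pp).
by rewrite -(@bin_fact m.*2 m) ?dvdn_mulr //; lia.
Qed.

(** In the absence of primes in [(n, 8n]], every prime factor is at most [n]. Those with [p^2 > 8n]
    have exponent at most 1 and are controlled by the primorial; the others are at most [s] in
    number, each contributing at most [8n]. *)
Lemma central_bin_le_of_gap n s :
  0 < n -> n * 8 < s.+1 ^ 2 ->
  (forall p, prime p -> n < p -> 8 * n < p) ->
  'C((4 * n).*2, 4 * n) <= 4 ^ n * (8 * n) ^ s.
Proof.
move=> n0 sn gap; set B := 'C(_, _).
have B0 : 0 < B by rewrite bin_gt0; lia.
have Bdvd p : prime p -> p %| B -> p <= n.
  move=> pp pd; rewrite leqNgt; apply/negP => /(gap _ pp).
  by have := prime_dvd_central_bin_le pp pd; lia.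
have -> : B = \prod_(0 <= p < n.+1 | prime p) p ^ logn p B.
  rewrite -[LHS](partnT B0) (widen_partn _ (leq_maxr n B)).
  rewrite [RHS](big_nat_widen _ _ (maxn n B).+1); last by lia.
  rewrite big_mkcond [RHS]big_mkcond /=; apply: eq_bigr => p _.
  rewrite ltnS lognE B0 /=; case: (boolP (prime p)) => //= pp.
  by case: (boolP (p %| B)) => [/(Bdvd _ pp)->|_] //=; case: ifP.
apply: leq_trans (_ : \prod_(0 <= p < n.+1 | prime p)
    (p * if p ^ 2 <= 8 * n then 8 * n else 1) <= _).
  apply: leq_prod => p pp; have p0 := prime_gt0 pp.
  have le := @pfactor_central_bin_le p (4 * n) pp ltac:(lia).
  have {}le : p ^ logn p B <= 8 * n by apply: leq_trans le _; lia.
  case: (leqP (p ^ 2)) => lt; first by apply: leq_trans le _; nia.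
  rewrite muln1 -[leqRHS]expn1 leq_exp2l ?prime_gt1 // -ltnS.
  by rewrite -(@ltn_exp2l p) ?prime_gt1 //; apply: leq_ltn_trans le _.
rewrite big_split /= leq_mul ?primorial_le //.
rewrite -big_mkcondr big_const_seq iter_muln_1 leq_pexp2l //; first by lia.
rewrite -size_filter.
apply: leq_trans (_ : size (index_iota 1 s.+1) <= s); last by rewrite size_iota subn1.
apply: uniq_leq_size => [|k]; first by rewrite filter_uniq // iota_uniq.
rewrite mem_filter !mem_index_iota => /andP[/andP[/prime_gt0 -> h] _] /=.
by rewrite -(@ltn_exp2r _ _ 2) //; apply: leq_ltn_trans h _; rewrite mulnC.
Qed.

Lemma expn8_lt_expn2 t : 56 <= t -> (t.+1) ^ 8 < 2 ^ t.
Proof.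
move=> ht; set u := t %/ 8.
have hu : 7 <= u by rewrite /u; lia.
have lt u' : 7 <= u' -> 8 * u'.+1 < 2 ^ u'.
  elim: u' => // u' IH; rewrite leq_eqVlt => /orP[/eqP <- //|h].
  by have := IH h; rewrite expnS; lia.
apply: leq_ltn_trans (_ : (8 * u.+1) ^ 8 < _).
  by rewrite leq_exp2r // /u; lia.
apply: leq_trans (_ : (2 ^ u) ^ 8 <= _); first by rewrite ltn_exp2r // lt.
by rewrite -expnM leq_exp2l // /u; lia.
Qed.

Lemma next_primeP n : [/\ n < next_prime n, prime (next_prime n) &
  forall p, prime p -> n < p -> next_prime n <= p].
Proof.
rewrite /next_prime; case: ex_minnP => q /andP[h1 h2] h; split=> // p pp np.
by apply: h; rewrite np pp.
Qed.

Lemma next_prime_le n : 400 <= n -> next_prime n <= 8 * n.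
Proof.
move=> hn; have [_ _ nextP] := next_primeP n.
rewrite leqNgt; apply/negP => gap.
(* [s] is the integer square root of [8n]; the threshold 400 makes it at least 56. *)
have ex : exists k, n * 8 < k.+1 ^ 2 by exists (n * 8); nia.
pose s := ex_minn ex; have [sn smin] : n * 8 < s.+1 ^ 2 /\ s ^ 2 <= n * 8.
  rewrite /s; case: ex_minnP => k hk kmin; split => //.
  case: k hk kmin => // k _ kmin; rewrite leqNgt; apply/negP => /kmin; lia.
have := @central_bin_le_of_gap n s ltac:(lia) sn
  (fun p pp np => leq_trans gap (nextP p pp np)).
apply/negP; rewrite -ltnNge.
apply: leq_trans (expn2_le_central_bin _).
rewrite -[4 in X in X < _]/(2 ^ 2) -expnM.
rewrite (_ : 4 * n = 2 * n + 2 * n); last by lia.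
rewrite expnD ltn_pmul2l ?expn_gt0 //.
have s56 : 56 <= s by rewrite leqNgt; apply/negP => h; nia.
case: s s56 sn smin => // s s56 sn smin.
(* With [s] the square root again, fourth powers give [(8n)^(4s) < (s+1)^(8s) < 2^(s^2) <=
   2^(8n)]. *)
rewrite -(@ltn_exp2r _ _ 4) // -!expnM.
apply: leq_ltn_trans (_ : (s.+2 ^ 2) ^ (s.+1 * 4) < _).
  by rewrite leq_exp2r ?muln_gt0 //; lia.
rewrite -expnM (_ : 2 * _ = 8 * s.+1); last by lia.
rewrite expnM; apply: leq_trans (_ : (2 ^ s.+1) ^ s.+1 <= _).
  by rewrite ltn_exp2r // expn8_lt_expn2.
by rewrite -expnM leq_exp2l //; lia.
Qed.

Lemma nth_prime_prime i : prime (nth_prime i).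
Proof. by case: i => //= i; case: (next_primeP (nth_prime i)). Qed.

Lemma nth_prime_ltS i : nth_prime i < nth_prime i.+1.
Proof. by case: (next_primeP (nth_prime i)). Qed.

Lemma nth_prime_gt i : i.+1 < nth_prime i.
Proof. by elim: i => // i IH; apply: leq_trans (nth_prime_ltS i). Qed.

(** * Pigeonhole arguments and the choice of the parameter *)

Local Open Scope ring_scope.

Lemma pigeonhole (T T' : finType) (f : T -> T') :
  (#|T'| < #|T|)%N -> exists x y, x != y /\ f x = f y.
Proof.
move=> lt; have : ~~ injectiveb f.
  by apply: contraL lt => /injectiveP/leq_card; rewrite -leqNgt.
by case/injectivePn => x [y xy fxy]; exists x, y.
Qed.

Lemma ffun_diff_small (d r : nat) (f g : {ffun 'I_d -> 'I_r.+1}) :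
  f != g -> let y j := (f j)%:Z - (g j)%:Z in
  (exists j, y j != 0) /\ forall j, `|y j| <= r%:Z.
Proof.
move=> fg y; split.
  case/boolP: [forall j, f j == g j] => [/forallP h|/forallPn[j h]].
    by case/eqP: fg; apply/ffunP => j; apply/eqP.
  by exists j; rewrite /y subr_eq0; apply: contra h => /eqP[/val_inj->].
by move=> j; have := ltn_ord (f j); have := ltn_ord (g j); rewrite /y; lia.
Qed.

(** On the box [{0..r}^d] the form [f -> \sum_j f_j w_j] takes at most [2drW + 1] values, so two
    vectors of the box collide; [y] is their difference. *)
Lemma exists_small_orthogonal (d r W : nat) (w : 'I_d -> int) :
  (forall j, `|w j| <= W%:Z) -> (2 * d * r * W + 1 < r.+1 ^ d)%N ->
  exists y : 'I_d -> int, [/\ exists j, y j != 0,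
    forall j, `|y j| <= r%:Z & \sum_j y j * w j = 0].
Proof.
move=> wW lt.
pose S (f : {ffun 'I_d -> 'I_r.+1}) : int := \sum_j (f j)%:Z * w j.
have bS f : `|S f| <= (d * r * W)%:Z.
  apply: le_trans (ler_norm_sum _ _ _) _.
  apply: le_trans (_ : \sum_(j < d) (r * W)%:Z <= _).
    apply: ler_sum => j _; rewrite normrM PoszM ler_pM //.
    by have := ltn_ord (f j); lia.
  by rewrite sumr_const card_ord -mulr_natl -mulnA !PoszM; lia.
have [f [g [fg E]]] := @pigeonhole _ _
  (fun f => inord (absz (S f + (d * r * W)%:Z)) : 'I_(2 * d * r * W).+1)
  ltac:(by rewrite card_ffun !card_ord -addn1).
have [h1 h2] := ffun_diff_small fg.
eexists; split; [exact: h1|exact: h2|].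
have -> : \sum_j ((f j)%:Z - (g j)%:Z) * w j = S f - S g.
  by rewrite /S -sumrB; apply: eq_bigr => j _; rewrite mulrBl.
move: E => /(congr1 val) /=; have := bS f; have := bS g => bg bf.
have <- : (2 * (d * r * W) = 2 * d * r * W)%N by rewrite !mulnA.
rewrite !inordK; lia.
Qed.

Lemma exists_small_dual (d r N : nat) (z : 'I_d -> nat) :
  (0 < N)%N -> (N < r.+1 ^ d)%N ->
  exists y : 'I_d -> int, [/\ exists j, y j != 0,
    forall j, `|y j| <= r%:Z & (N%:Z %| \sum_j y j * (z j)%:Z)%Z].
Proof.
case: N => // N _ lt.
pose S (f : {ffun 'I_d -> 'I_r.+1}) : nat := (\sum_j f j * z j)%N.
have [f [g [fg E]]] := @pigeonhole _ _ (fun f => inord (S f %% N.+1) : 'I_N.+1)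
  ltac:(by rewrite card_ffun !card_ord).
have [h1 h2] := ffun_diff_small fg.
eexists; split; [exact: h1|exact: h2|].
have -> : \sum_j ((f j)%:Z - (g j)%:Z) * (z j)%:Z = (S f)%:Z - (S g)%:Z.
  rewrite /S !(big_morph Posz PoszD (erefl _)) -sumrB; apply: eq_bigr => j _.
  by rewrite mulrBl !PoszM.
move: E => /(congr1 val) /=; rewrite !inordK ?ltn_pmod // => E.
by rewrite -eqz_mod_dvd !modz_nat E.
Qed.

(** Since [r < N], a nonzero [y] stays nonzero modulo [N], so [\sum_j y_j X^j] has at most [d] roots
    in the field. The [(2r+1)^d] choices of [y] therefore exclude fewer than [N - 1] residues. *)
Lemma exists_good_multiplier (d N r : nat) :
  prime N -> (r < N)%N -> (r.*2.+1 ^ d * d < N.-1)%N ->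
  exists b, (1 <= b <= N.-1)%N /\
    forall y : 'I_d -> int, (exists j, y j != 0) -> (forall j, `|y j| <= r%:Z) ->
    ~~ (N%:Z %| \sum_j y j * (korobov_z N b j)%:Z)%Z.
Proof.
move=> pN rN lt.
have chN : N \in [pchar 'F_N] by rewrite pchar_Fp.
pose c (f : {ffun 'I_d -> 'I_r.*2.+1}) : 'rV['F_N]_d :=
  \row_j ((f j)%:Z - r%:Z)%:~R.
(* The zero polynomial vanishes everywhere, hence the first condition. *)
pose A f := [set b : 'F_N | (c f != 0) && root (rVpoly (c f)) b].
have cardA f : (#|A f| <= d)%N.
  have [E|cf] := eqVneq (c f) 0.
    by rewrite eq_card0 // => b; rewrite !inE E eqxx.
  have pf : rVpoly (c f) != 0.
    by apply: contra cf => /eqP h; rewrite -[c f]rVpolyK h linear0.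
  rewrite cardE -ltnS; apply: leq_trans (_ : (size (rVpoly (c f)) <= _)%N).
    apply: max_poly_roots; rewrite ?enum_uniq //.
    by apply/allP => b; rewrite mem_enum inE => /andP[].
  by apply: leq_trans (size_poly _ _) _.
pose P := [set A f | f in [set: {ffun 'I_d -> 'I_r.*2.+1}]].
have cardP : (#|finset.cover P| < N.-1)%N.
  apply: leq_ltn_trans (leq_card_cover P).1 _.
  apply: leq_ltn_trans lt; apply: leq_trans (_ : \sum_(B in P) d <= _)%N.
    by apply: leq_sum => B /imsetP[f _ ->].
  rewrite sum_nat_const leq_mul2r; apply/orP; right.
  by apply: leq_trans (leq_imset_card _ _) _; rewrite cardsT card_ffun !card_ord.
have [b b0 bP] : exists2 b : 'F_N, b != 0 & b \notin finset.cover P.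
  apply/exists_inP; apply: contraLR cardP; rewrite negb_exists_in => /forall_inP h.
  rewrite -leqNgt; apply: (@leq_trans #|[set~ (0 : 'F_N)]|).
    by rewrite cardsC1 card_Fp.
  by apply/subset_leq_card/fintype.subsetP => b; rewrite !inE => /h; rewrite negbK.
have bN : (b < N)%N by rewrite -[leqRHS](Fp_cast pN).
exists b; split.
  rewrite lt0n -ltnS prednK ?prime_gt0 // bN andbT.
  by apply: contra b0 => /eqP h; apply/eqP/val_inj.
move=> y [j yj] yr; apply: contra bP => dv.
pose f : {ffun 'I_d -> 'I_r.*2.+1} := [ffun j => inord (absz (y j + r%:Z))].
have cfE i : c f 0 i = (y i)%:~R.
  rewrite mxE ffunE inordK; last by have := yr i; lia.
  by congr (_%:~R); have := yr i; lia.
apply/bigcupP; exists (A f); first by rewrite imset_f.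
rewrite inE; apply/andP; split.
  apply: contra yj => /eqP /rowP/(_ j); rewrite cfE mxE => /eqP.
  rewrite -(dvdz_pcharf chN) => /dvdzP[q qE].
  have := yr j; rewrite qE; have [->|q0] := eqVneq q 0; first by rewrite mul0r eqxx.
  rewrite normrM => h; have : 1 * N%:Z <= r%:Z by apply: le_trans h; rewrite ler_pM //; lia.
  lia.
rewrite /root (horner_coef_wide _ (size_poly _ _)).
move: dv; rewrite (dvdz_pcharf chN) rmorph_sum /= => /eqP E; apply/eqP.
rewrite -[RHS]E; apply: eq_bigr => i _.
rewrite coef_rVpoly_ord cfE rmorphM /=; congr (_ * _).
by rewrite /korobov_z -pmulrn Fp_nat_mod // natrX natr_Zp.
Qed.

(** * Lattices and their duals *)

Section Norm.
Variables (R : realType) (d : nat).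
Implicit Types (x y : 'rV[R]_d) (L : set 'rV[R]_d).

Lemma enorm_ge0 x : 0 <= enorm x.
Proof. exact: sqrtr_ge0. Qed.

Lemma ler_norm_enorm x j : `|x 0 j| <= enorm x.
Proof.
rewrite -sqrtr_sqr ler_wsqrtr // (bigD1 j) //= lerDl.
by apply: sumr_ge0 => i _; apply: sqr_ge0.
Qed.

Lemma enorm_le x (B : R) : 0 <= B -> (forall j, `|x 0 j| <= B) -> enorm x <= d%:R * B.
Proof.
move=> B0 xB; have dB0 : 0 <= d%:R * B by rewrite mulr_ge0.
rewrite -[leRHS](ger0_norm dB0) -sqrtr_sqr ler_wsqrtr //.
apply: le_trans (_ : \sum_(j < d) B ^+ 2 <= _).
  by apply: ler_sum => j _; rewrite -real_normK ?num_real // ler_pXn2r ?nnegrE.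
rewrite sumr_const card_ord -[leLHS]mulr_natl exprMn ler_wpM2r ?sqr_ge0 //.
by rewrite -natrX ler_nat; case: (d) => // n; rewrite leq_pmulr.
Qed.

Lemma lambda1_le L x : L x -> x != 0 -> lambda1 L <= enorm x.
Proof.
move=> Lx x0; apply: ge_inf; last by exists x.
by exists 0 => _ [v _ <-]; apply: enorm_ge0.
Qed.

(** A nonzero vector is required because [inf] of the empty set is 0. *)
Lemma le_lambda1 L (B : R) :
  (exists2 x, L x & x != 0) -> (forall x, L x -> x != 0 -> B <= enorm x) ->
  B <= lambda1 L.
Proof.
move=> [x Lx x0] h; apply: lb_le_inf; first by exists (enorm x), x.
by move=> _ [v [Lv v0] <-]; apply: h.
Qed.

Lemma lambda1_ge0 L : 0 <= lambda1 L.
Proof.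
have [[x [Lx x0]]|h] := pselect (exists x, L x /\ x != 0).
  by apply: le_lambda1 => [|y _ _]; [exists x|exact: enorm_ge0].
rewrite /lambda1 (_ : [set enorm v | v in _]%classic = set0) ?inf0 //.
by apply/seteqP; split=> // x [v hv _]; apply: h; exists v.
Qed.

End Norm.

Section Lattice.
Variables (R : realType) (d N : nat) (z : 'I_d -> nat).
Hypothesis N0 : (0 < N)%N.
Local Notation L := (@rank1_lattice R d N z).

Let NR0 : N%:R != 0 :> R.
Proof. by rewrite pnatr_eq0 -lt0n. Qed.

Lemma rank1_lattice_comb (n : nat) (c : 'I_n -> int) (v : 'I_n -> 'rV[R]_d) :
  (forall i, L (v i)) -> L (\sum_i (c i)%:~R *: v i).
Proof.
move=> /choice[k] /choice[m] E.
exists (\sum_i c i * k i), (fun j => \sum_i c i * m i j) => j.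
rewrite summxE !rmorph_sum /= !mulr_suml -big_split /=.
by apply: eq_bigr => i _; rewrite mxE E !rmorphM /=; ring.
Qed.

Lemma rank1_latticeB v w : L v -> L w -> L (v - w).
Proof.
move=> [k [m E]] [k' [m' E']]; exists (k - k'), (fun j => m j - m' j) => j.
by rewrite !mxE E E' !rmorphB /=; ring.
Qed.

Lemma rank1_lattice_int (m : 'I_d -> int) : L (\row_j (m j)%:~R).
Proof. by exists 0, m => j; rewrite mxE !mul0r add0r. Qed.

(** Testing against the unit vectors forces integral entries; testing against [z / N] gives the
    congruence. These vectors generate the lattice. *)
Lemma dual_rank1_latticeP (y : 'rV[R]_d) :
  dual_lattice L y <-> exists t : 'I_d -> int,
    (forall j, y 0 j = (t j)%:~R) /\ (N%:Z %| \sum_j t j * (z j)%:Z)%Z.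
Proof.
split=> [Dy|[t [yE /dvdzP[q qE]]] x [k [m xE]]].
  have /choice[t yE] : forall j, exists t : int, y 0 j = t%:~R.
    move=> j; have [t E] := Dy _ (rank1_lattice_int (fun i => (i == j)%:Z)).
    exists t; rewrite -E /dotp (bigD1 j) //= big1 => [|i /negPf ij].
      by rewrite mxE eqxx mul1r addr0.
    by rewrite mxE ij mul0r.
  exists t; split => //.
  have Lz : L (\row_j ((z j)%:R / N%:R)).
    by exists 1, (fun=> 0) => j; rewrite mxE mul1r addr0.
  have [q qE] := Dy _ Lz; apply/dvdzP; exists q.
  apply: (@intr_inj R); rewrite rmorphM /= -qE /dotp mulr_suml rmorph_sum /=.
  by apply: eq_bigr => j _; rewrite mxE yE rmorphM /= -!pmulrn; field.
exists (k * q + \sum_j m j * t j).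
rewrite rmorphD !rmorphM !rmorph_sum /=.
have -> : q%:~R = (\sum_j (t j)%:~R * (z j)%:R) / N%:R :> R.
  apply: (canRL (mulfK _)) => //.
  rewrite [N%:R]pmulrn -rmorphM /= -qE rmorph_sum /=.
  by apply: eq_bigr => j _; rewrite rmorphM.
rewrite /dotp mulrA mulr_sumr mulr_suml -big_split /=.
by apply: eq_bigr => j _; rewrite xE yE rmorphM /=; ring.
Qed.

End Lattice.

Lemma int_row_neq0 (R : realType) d (y : 'I_d -> int) (x : 'rV[R]_d) :
  (forall j, x 0 j = (y j)%:~R) -> (exists j, y j != 0) <-> x != 0.
Proof.
move=> xE; split=> [[j]|]; last first.
  move=> x0; apply: contrapT => h; case/eqP: x0; apply/rowP => j; rewrite mxE xE.
  have [->//|yj] := eqVneq (y j) 0; by case: h; exists j.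
by apply: contra => /eqP x0; rewrite -(intr_eq0 R) -xE x0 mxE.
Qed.

Lemma lambda1_dual_le (R : realType) (d N r : nat) (z : 'I_d -> nat) :
  (0 < N)%N -> (N < r.+1 ^ d)%N ->
  lambda1 (dual_lattice (@rank1_lattice R d N z)) <= (d * r)%:R.
Proof.
move=> N0 lt; have [y [y0 yr yN]] := exists_small_dual z N0 lt.
pose x : 'rV[R]_d := \row_j (y j)%:~R.
have xE j : x 0 j = (y j)%:~R by rewrite mxE.
apply: le_trans (lambda1_le (x := x) _ _) _.
- by apply/(dual_rank1_latticeP _ N0 _); exists y.
- exact/(int_row_neq0 xE).
rewrite natrM; apply: enorm_le => [//|j].
by rewrite xE -intr_norm pmulrn ler_int.
Qed.

Lemma dual_nonzero (R : realType) (d N : nat) (z : 'I_d -> nat) :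
  (0 < d)%N -> (0 < N)%N ->
  exists2 x, dual_lattice (@rank1_lattice R d N z) x & x != 0.
Proof.
move=> d0 N0; exists (\row_j N%:R).
  apply/(dual_rank1_latticeP _ N0 _); exists (fun=> N%:Z); split=> [j|].
    by rewrite mxE pmulrn.
  by rewrite -mulr_sumr dvdz_mulr.
apply/(@int_row_neq0 R d (fun=> N%:Z)); first by move=> j; rewrite mxE pmulrn.
by exists (Ordinal d0); lia.
Qed.

Lemma rank1_lattice_nonzero (R : realType) (d N : nat) (z : 'I_d -> nat) :
  (0 < d)%N -> exists2 x, @rank1_lattice R d N z x & x != 0.
Proof.
move=> d0; exists (\row_j 1%:~R); first exact: rank1_lattice_int.
apply/(@int_row_neq0 R d (fun=> 1)); first by move=> j; rewrite mxE.
by exists (Ordinal d0).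
Qed.

Lemma enorm_int_ge (R : realType) d (y : 'I_d -> int) (x : 'rV[R]_d) (r : nat) :
  (forall j, x 0 j = (y j)%:~R) -> (exists j, r%:Z <= `|y j|) -> r%:R <= enorm x.
Proof.
move=> xE [j h]; apply: le_trans (ler_norm_enorm x j).
by rewrite xE -intr_norm pmulrn ler_int.
Qed.

(** * Lower bounds on shortest vectors for a good parameter *)

Section GoodMultiplier.
Variables (R : realType) (d N r : nat) (z : 'I_d -> nat).
Hypotheses (d0 : (0 < d)%N) (pN : prime N) (r0 : (0 < r)%N).
Hypothesis good : forall y : 'I_d -> int, (exists j, y j != 0) ->
  (forall j, `|y j| <= r%:Z) -> ~~ (N%:Z %| \sum_j y j * (z j)%:Z)%Z.

Lemma lambda1_dual_ge : r%:R <= lambda1 (dual_lattice (@rank1_lattice R d N z)).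
Proof.
have N0 := prime_gt0 pN.
apply: le_lambda1 (dual_nonzero _ _ d0 N0) _ => x /(dual_rank1_latticeP _ N0 _)[y [xE dv]].
move=> /(int_row_neq0 xE) y0.
apply: (enorm_int_ge xE); apply: contrapT => h.
have := good y0; rewrite dv => /(_ _)/negP; apply=> // j; rewrite leNgt; apply/negP => lt.
by apply: h; exists j; apply: ltW.
Qed.

(* A short vector [v = w / N] of the lattice forces, by the pigeonhole principle,
   a short integer vector exactly orthogonal to [w], hence in the dual lattice. *)
Lemma lambda1_rank1_ge : (r ^ d <= 2 * d * r * N)%N ->
  (r ^ d)%:R / (2 * d * r * N)%:R <= lambda1 (@rank1_lattice R d N z).
Proof.
move=> rN; have N0 := prime_gt0 pN.
have den0 : 0 < (2 * d * r * N)%:R :> R by rewrite ltr0n !muln_gt0 d0 r0 N0.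
have NR0 : 0 < N%:R :> R by rewrite ltr0n.
apply: le_lambda1 (rank1_lattice_nonzero _ _ _ d0) _ => v [k [m vE]] v0.
pose w j := k * (z j)%:Z + N%:Z * m j.
have vw j : v 0 j = (w j)%:~R / N%:R.
  rewrite vE rmorphD !rmorphM /= -!pmulrn; field; exact: lt0r_neq0.
(* If [N] divides [k], then [v] is integral and has length at least 1, while [rN] makes the claimed
   bound at most 1. *)
have [/dvdzP[q qE]|Nk] := boolP (N%:Z %| k)%Z.
  have vint j : v 0 j = (q * (z j)%:Z + m j)%:~R.
    by rewrite vE qE rmorphD !rmorphM /= -!pmulrn; field; exact: lt0r_neq0.
  apply: (@le_trans _ _ 1%:R); first by rewrite ler_pdivrMr // mul1r ler_nat.
  apply: (enorm_int_ge vint).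
  by case/(int_row_neq0 vint): v0 => j hj; exists j; lia.
pose W := \max_j absz (w j).
have wW j : `|w j| <= W%:Z.
  by rewrite -abszE lez_nat; apply: (leq_bigmax (F := fun j => absz (w j))).
have [|j jW] := @bigop.eq_bigmax _ (fun j => absz (w j)); first by rewrite card_ord.
rewrite -/W in jW.
have rW : (r ^ d <= 2 * d * r * W)%N.
  rewrite leqNgt; apply/negP => lt.
  have lt' : (2 * d * r * W + 1 < r.+1 ^ d)%N.
    by rewrite addn1; apply: leq_ltn_trans lt _; rewrite ltn_exp2r.
  have [y [y0 yr yw]] := exists_small_orthogonal wW lt'.
  move/negP: (good y0 yr); apply.
  (* Orthogonality to [w = k z + N m] only gives divisibility after multiplication by [k], which is
     prime to [N]. *)
  suff : (N%:Z %| k * \sum_j y j * (z j)%:Z)%Z.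
    rewrite Gauss_dvdzr // coprimezE /= prime_coprime //.
  have -> : k * (\sum_j y j * (z j)%:Z) = - (\sum_j y j * m j) * N%:Z.
    apply/eqP; rewrite mulNr -addr_eq0; apply/eqP; rewrite -[RHS]yw.
    rewrite mulr_sumr mulr_suml -big_split /=; apply: eq_bigr => i _.
    rewrite /w; ring.
  exact: dvdz_mull.
apply: le_trans (ler_norm_enorm v j).
rewrite vw normrM -intr_norm -abszE -jW [`|_^-1|]gtr0_norm ?invr_gt0 //.
rewrite ler_pdivrMr // -pmulrn mulrAC ler_pdivlMr // -!natrM ler_nat.
by rewrite mulnA [(W * _)%N]mulnC leq_mul2r rW orbT.
Qed.

Lemma lambda1_product_ge : (r ^ d <= N)%N ->
  (r ^ d)%:R / (2 * d * N)%:R <=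
    lambda1 (@rank1_lattice R d N z) * lambda1 (dual_lattice (@rank1_lattice R d N z)).
Proof.
move=> rN; have N0 := prime_gt0 pN.
have rN' : (r ^ d <= 2 * d * r * N)%N by rewrite (leq_trans rN) // leq_pmull // !muln_gt0 d0 r0.
have := ler_pM (divr_ge0 (ler0n _ _) (ler0n _ _)) (ler0n R r) (lambda1_rank1_ge rN') lambda1_dual_ge.
apply: le_trans.
rewrite !natrM le_eqVlt; apply/orP; left; apply/eqP; field.
by rewrite !pnatr_eq0 -!lt0n r0 d0 N0.
Qed.

End GoodMultiplier.

(** Used to extract integer [d]-th roots; [r <= f r] bounds the search. *)
Lemma exists_last_le (X : nat) (f : nat -> nat) :
  (f 0%N <= X)%N -> (forall r, (r <= f r)%N) ->
  exists r, (f r <= X)%N /\ (X < f r.+1)%N.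
Proof.
move=> f0 fr.
have ex : exists r, (f r <= X)%N by exists 0%N.
have ub r : (f r <= X -> r <= X)%N by apply: leq_trans.
case: (ex_maxnP ex ub) => r hr rmax; exists r; split => //.
by rewrite ltnNge; apply/negP => /rmax; rewrite ltnn.
Qed.

(** For the largest [r] with [d (2r+1)^d <= N - 2], maximality and [2r + 3 <= 5r] give
    [N <= 2 d 5^d r^d], so that [r^d / (2dN)] is at least the stated constant. The lower bound on
    [N] ensures [r >= 1]. *)
Lemma exists_good_korobov (R : realType) (d N : nat) :
  (0 < d)%N -> prime N -> (d * 3 ^ d + 1 < N)%N ->
  exists b, (1 <= b <= N.-1)%N /\
    (4 * d * d * 5 ^ d)%:R^-1 <=
    lambda1 (@korobov_lattice R d N b) * lambda1 (dual_lattice (@korobov_lattice R d N b)).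
Proof.
move=> d0 pN hN.
have [|r|r [rlo rhi]] := @exists_last_le (N - 2)%N (fun r => r.*2.+1 ^ d * d)%N.
- by rewrite exp1n; have := expn_gt0 3 d; nia.
- apply: leq_trans (_ : r.*2.+1 <= _)%N; first by lia.
  by apply: leq_trans (leq_pmulr _ d0); rewrite -[X in (X <= _)%N]expn1 leq_pexp2l.
have r0 : (0 < r)%N.
  case: r rlo rhi => [|r] // _ h.
  have h' : (N - 2 < 3 ^ d * d)%N by [].
  lia.
have rrd : (r ^ d <= r.*2.+1 ^ d * d)%N.
  apply: leq_trans (leq_pmulr _ d0); rewrite leq_exp2r //; lia.
have rd : (r <= r ^ d)%N by rewrite -[X in (X <= _)%N]expn1 leq_pexp2l.
have [||b [b1 good]] := @exists_good_multiplier d N r pN; [lia|lia|].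
exists b; split => //.
apply: le_trans (lambda1_product_ge R d0 pN r0 good _); last by lia.
have N0 := prime_gt0 pN.
rewrite ler_pdivlMr ?ltr0n ?muln_gt0 ?d0 // mulrC ler_pdivrMr; last first.
  by rewrite ltr0n !muln_gt0 d0 expn_gt0.
rewrite -natrM ler_nat.
have h : (r.+1.*2.+1 ^ d <= 5 ^ d * r ^ d)%N by rewrite -expnMn leq_exp2r //; lia.
have : (N <= 2 * (5 ^ d * r ^ d * d))%N by nia.
set X := (5 ^ d)%N; set Y := (r ^ d)%N => hh.
rewrite (_ : Y * _ = 2 * d * (2 * (X * Y * d)))%N; last by lia.
by rewrite leq_mul2l hh orbT.
Qed.

(** * Covering by short lattice vectors *)

(** Greedy choice: fewer than [d] rows are annihilated by a common nonzero column [u], taken from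
    [cokermx A], and any [v] in [S] with [v *m u != 0] is independent of them. *)
Lemma exists_independent_rows (F : fieldType) (d : nat) (S : 'rV[F]_d -> Prop) :
  (forall u : 'cV[F]_d, u != 0 -> exists2 v, S v & v *m u != 0) ->
  forall n, (n <= d)%N -> exists A : 'M[F]_(n, d), row_free A /\ forall i, S (row i A).
Proof.
move=> span; elim=> [|n IH] nd.
  by exists 0; split => [|[]//]; rewrite /row_free mxrank0.
have [A [freeA SA]] := IH (ltnW nd).
have [j uj] : exists j, col j (cokermx A) != 0.
  apply: contrapT => h.
  have : row_full A.
    rewrite -cokermx_eq0; apply/eqP/matrixP => i j; rewrite [RHS]mxE.
    have [/colP/(_ i)|cj] := eqVneq (col j (cokermx A)) 0; first by rewrite !mxE.
    by case: h; exists j.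
  move: freeA nd; rewrite /row_free /row_full => /eqP -> nd /eqP E.
  by rewrite E ltnn in nd.
set u := col j _ in uj.
have Au : A *m u = 0 by rewrite /u colE mulmxA mulmx_coker mul0mx.
have [v Sv vu] := span u uj.
suff [B hB] : exists B : 'M[F]_(1 + n, d), row_free B /\ forall i, S (row i B).
  by exists B.
exists (col_mx v A); split; last first.
  move=> i; case: (@split_ordP 1 n i) => i' ->; last by rewrite rowKd.
  by rewrite rowKu (_ : row i' v = v) //; apply/rowP => l; rewrite mxE (ord1 i').
apply: (@inj_row_free _ (1 + n)) => w; rewrite -[w]hsubmxK mul_row_col => E.
have w0 : lsubmx w = 0.
  have := congr1 (mulmx^~ u) E; rewrite mulmxDl -!mulmxA Au mulmx0 addr0 mul0mx.
  move: vu; rewrite [v *m u]mx11_scalar mul_mx_scalar => c0 /eqP.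
  rewrite scaler_eq0 => /orP[/eqP c|/eqP//]; by rewrite c raddf0 eqxx in c0.
move/eqP: E; rewrite w0 mul0mx add0r mulmx_free_eq0 // => /eqP ->.
exact: row_mx0.
Qed.

Lemma frac_itv (R : realType) (x : R) : 0 <= Defs.frac x < 1.
Proof. by have := floor_itv x; rewrite /Defs.frac rmorphD /=; lra. Qed.

Lemma frac_shift (R : realType) (x : R) (m : int) : 0 <= x + m%:~R < 1 ->
  Defs.frac x = x + m%:~R.
Proof.
move=> h; rewrite /Defs.frac (_ : Num.floor x = - m) ?rmorphN ?opprK //.
by apply: floor_def; rewrite rmorphD rmorphN /=; lra.
Qed.

(** For [q > 0] the type is ['I_q], in the successor form that [inord] needs; on [[0,1)] the index
    is in range. *)
Definition grid_cell (R : realType) (q : nat) (x : R) : 'I_q.-1.+1 :=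
  inord (Num.truncn (q%:R * x)).

Lemma grid_cell_close (R : realType) (q : nat) (x y : R) : (0 < q)%N ->
  0 <= x < 1 -> 0 <= y < 1 -> grid_cell q x = grid_cell q y -> `|x - y| <= q%:R^-1.
Proof.
move=> q0 hx hy /(congr1 val) /=.
have q0' : 0 < q%:R :> R by rewrite ltr0n.
have bd (w : R) : 0 <= w < 1 -> (Num.truncn (q%:R * w) < q)%N.
  by move=> hw; rewrite truncn_lt_nat; nra.
rewrite !inordK ?prednK ?bd // => E.
have := @truncn_itv R (q%:R * x) ltac:(nra); have := @truncn_itv R (q%:R * y) ltac:(nra).
rewrite E; set t := Num.truncn _ => h1 h2.
rewrite -(ler_pM2l q0') mulfV ?lt0r_neq0 // -[X in X * _](gtr0_norm q0') -normrM.
move: h1 h2; rewrite -natr1 ler_norml; lra.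
Qed.

(** * Rank-1 point sets as lattice points of the half-open cube *)

Section Points.
Variables (R : realType) (d N : nat) (z : 'I_d -> nat).
Hypothesis N0 : (0 < N)%N.
Local Notation L := (@rank1_lattice R d N z).
Local Notation P := (@rank1_pts R d N z).

Let NR0 : 0 < N%:R :> R.
Proof. by rewrite ltr0n. Qed.

Definition rank1_pt (n : nat) : 'rV[R]_d := \row_j Defs.frac (n%:R * (z j)%:R / N%:R).

Lemma rank1_ptsP x : reflect (exists2 n, (n < N)%N & x = rank1_pt n) (x \in P).
Proof.
apply: (iffP mapP) => [[n]|[n nN ->]].
  by rewrite mem_iota => nN ->; exists n.
by exists n; rewrite ?mem_iota.
Qed.

Lemma rank1_pt_lattice n : L (rank1_pt n).
Proof.
exists n%:Z, (fun j => - Num.floor (n%:R * (z j)%:R / N%:R : R)) => j.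
by rewrite mxE /Defs.frac rmorphN -pmulrn.
Qed.

Lemma mem_rank1_pts v : L v -> (forall j, 0 <= v 0 j < 1) -> v \in P.
Proof.
move=> [k [m vE]] v01; apply/rank1_ptsP.
have kN : (k %% N)%Z < N%:Z by rewrite ltz_pmod // ltz_nat.
have k0 : 0 <= (k %% N)%Z by rewrite modz_ge0 //; lia.
pose n := absz (k %% N)%Z.
have kE : k%:~R = (k %/ N)%Z%:~R * N%:R + n%:R :> R.
  by rewrite {1}(divz_eq k N) rmorphD rmorphM /= -pmulrn [n%:R]pmulrn abszE ger0_norm.
exists n; first by rewrite /n; lia.
(* Reducing [k] modulo [N] moves a multiple of [z] into the integer part. *)
have vjE j : n%:R * (z j)%:R / N%:R + ((k %/ N)%Z * (z j)%:Z + m j)%:~R = v 0 j.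
  rewrite vE kE rmorphD rmorphM /= -[(z j)%:~R]pmulrn.
  by field; rewrite lt0r_neq0.
by apply/rowP => j; rewrite mxE (@frac_shift _ _ ((k %/ N)%Z * (z j)%:Z + m j)) vjE.
Qed.

End Points.

Lemma rank1_pt_inj (R : realType) (d N : nat) (z : 'I_d.+1 -> nat) (n n' : nat) :
  z ord0 = 1%N -> (n < N)%N -> (n' < N)%N ->
  rank1_pt R N z n = rank1_pt R N z n' -> n = n'.
Proof.
move=> z0 nN nN' /rowP/(_ ord0); rewrite !mxE z0 !mulr1.
have NR0 : 0 < N%:R :> R by rewrite ltr0n; case: (N) nN.
have E i : (i < N)%N -> Defs.frac (i%:R / N%:R : R) = i%:R / N%:R.
  move=> iN; rewrite (@frac_shift _ _ 0) ?addr0 // divr_ge0 //=.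
  by rewrite ltr_pdivrMr // mul1r ltr_nat.
rewrite !E // => /(mulIf (invr_neq0 (lt0r_neq0 NR0)))/eqP.
by rewrite eqr_nat => /eqP.
Qed.

(* Cut the coordinate where [u] is largest into [m] intervals and the others into [m * k]:
   two of the [N] points share a cell. If their difference is orthogonal to [u], its small
   coordinates control the remaining one, and the two points are too close. *)
Lemma short_vectors_span (R : realType) (d N m k : nat) (z : 'I_d.+1 -> nat)
    (u : 'cV[R]_d.+1) :
  z ord0 = 1%N -> (0 < m)%N -> (0 < k)%N -> (m * (m * k) ^ d < N)%N ->
  (d.+1 * d.+1)%:R / (m * k)%:R < lambda1 (@rank1_lattice R _ N z) ->
  u != 0 ->
  exists2 v, @rank1_lattice R _ N z v /\ (forall j, `|v 0 j| <= m%:R^-1) &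
    v *m u != 0.
Proof.
move=> z0 m0 k0 lt ltL u0.
have mk0 : (0 < m * k)%N by rewrite muln_gt0 m0.
have N0 : (0 < N)%N by case: (N) lt.
case: (arg_maxP (fun j => `|u j 0|) (erefl true : xpredT (ord0 : 'I_d.+1))) => j0 _ maxj.
have uj0 : 0 < `|u j0 0|.
  rewrite normr_gt0; apply: contra u0 => /eqP E; apply/eqP/colP => j.
  by have := maxj j isT; rewrite E normr0 /= normr_le0 mxE => /eqP.
pose p (n : 'I_N) := rank1_pt R N z n.
have [|n [n' [nn' E]]] := @pigeonhole 'I_N ('I_m.-1.+1 * {ffun 'I_d -> 'I_(m * k).-1.+1})%type
  (fun n => (grid_cell m (p n 0 j0), [ffun j => grid_cell (m * k) (p n 0 (lift j0 j))])).
  by rewrite card_prod card_ffun !card_ord !prednK.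
case: E => E0 /ffunP E1; pose v := p n - p n'.
have Lv : rank1_lattice N z v by apply: rank1_latticeB; apply: rank1_pt_lattice.
have v0 : v != 0.
  rewrite subr_eq0; apply: contra nn' => /eqP/(rank1_pt_inj z0 (ltn_ord n) (ltn_ord n')) h.
  exact/eqP/val_inj.
have vj0 : `|v 0 j0| <= m%:R^-1.
  by rewrite !mxE in E0 *; apply: grid_cell_close; rewrite ?frac_itv.
have vj j : `|v 0 (lift j0 j)| <= (m * k)%:R^-1.
  by have := E1 j; rewrite !ffunE /p !mxE; apply: grid_cell_close; rewrite ?frac_itv.
have mk1 : (m * k)%:R^-1 <= m%:R^-1 :> R.
  by rewrite lef_pV2 ?posrE ?ltr0n // ler_nat leq_pmulr.
exists v; first split=> // j.
  by case: (unliftP j0 j) => [j' ->|->] //; apply: le_trans (vj j') mk1.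
apply/negP => /eqP/matrixP/(_ 0 0); rewrite !mxE (bigD1_ord j0) //= => /eqP.
rewrite addr_eq0 => /eqP vu; move: ltL; apply/negP; rewrite -leNgt.
(* Solve [v *m u = 0] for the entry [j0]; as [u] is largest there, the other [d] terms contribute at
   most [1 / (m k)] each. *)
have vj0' : `|v 0 j0| <= d%:R / (m * k)%:R.
  rewrite -(ler_pM2r uj0) -normrM vu normrN.
  apply: le_trans (ler_norm_sum _ _ _) _.
  apply: (@le_trans _ _ (\sum_(j < d) `|u j0 0| / (m * k)%:R)).
    apply: ler_sum => j _; rewrite normrM mulrC ler_pM //; exact: maxj.
  by rewrite sumr_const card_ord -[leLHS]mulr_natl mulrCA mulrC.
apply: le_trans (lambda1_le Lv v0) _.
rewrite natrM -mulrA; apply: enorm_le => [|j]; first by rewrite divr_ge0.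
have mkV : 0 <= (m * k)%:R^-1 :> R by rewrite invr_ge0.
have d0 : 0 <= d%:R :> R by [].
case: (unliftP j0 j) => [j' ->|->].
  by apply: le_trans (vj j') _; rewrite -natr1; nra.
by apply: le_trans vj0' _; rewrite -natr1; nra.
Qed.

(** * Fill distance and separation radius *)

Section MeshRatio.
Variables (R : realType) (d N : nat) (z : 'I_d -> nat).
Hypothesis N0 : (0 < N)%N.
Local Notation L := (@rank1_lattice R d N z).
Local Notation P := (@rank1_pts R d N z).

(** The short vectors contain a basis of the space. Rounding down the coordinates of [x] in it
    leaves [d] basis vectors with coefficients in [[0,1)]. *)
Lemma rank1_lattice_covering (e : R) :
  (forall u : 'cV[R]_d, u != 0 ->
     exists2 v, L v /\ (forall j, `|v 0 j| <= e) & v *m u != 0) ->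
  forall x : 'rV[R]_d, exists2 v, L v & forall j, `|x 0 j - v 0 j| <= d%:R * e.
Proof.
move=> span x.
have [A [freeA SA]] := exists_independent_rows span (leqnn d).
have uA : A \in unitmx by rewrite -row_free_unit.
have [t ->] : exists t : 'rV_d, x = \sum_i t 0 i *: row i A.
  by exists (x *m invmx A); rewrite -mulmx_sum_row mulmxKV.
exists (\sum_i (Num.floor (t 0 i))%:~R *: row i A).
  by apply: rank1_lattice_comb => i; case: (SA i).
move=> j; rewrite !summxE -sumrB; apply: le_trans (ler_norm_sum _ _ _) _.
apply: (@le_trans _ _ (\sum_(i < d) e)); last by rewrite sumr_const card_ord mulr_natl.
apply: ler_sum => i _; have [_ /(_ j)] := SA i; rewrite !mxE -mulrBl normrM.
have : `|t 0 i - (Num.floor (t 0 i))%:~R| <= 1.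
  by have := floor_itv (t 0 i); rewrite rmorphD /= ler_norml; lra.
by move=> h1 h2; rewrite -[leRHS]mul1r ler_pM.
Qed.

Lemma mindist_le (x y : 'rV[R]_d) (Q : seq 'rV[R]_d) : y \in Q -> mindist x Q <= edist x y.
Proof.
move=> yQ; apply: ge_inf; last by exists y.
by exists 0 => _ [w _ <-]; apply: enorm_ge0.
Qed.

(* A point of the cube is first pushed inside by [2 * e], so that the nearby lattice
   point lies in the cube. *)
Lemma fill_dist_le (e : R) : 0 < e -> 4 * e <= 1 ->
  (forall x : 'rV[R]_d, exists2 v, L v & forall j, `|x 0 j - v 0 j| <= e) ->
  fill_dist P <= d%:R * (3 * e).
Proof.
move=> e0 e1 cov; apply: ge_sup.
  by exists (mindist 0 P), 0 => // j; rewrite mxE lexx ler01.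
move=> _ [x x01 <-].
(* The cube is contracted into [[2e, 1 - 2e]^d], moving each coordinate by at most [2e]; the lattice
   point adds [e], whence [3e]. *)
have [v Lv xv] := cov (\row_j (2 * e + (1 - 4 * e) * x 0 j)).
have {}xv j : - e <= 2 * e + (1 - 4 * e) * x 0 j - v 0 j <= e.
  by have := xv j; rewrite mxE ler_norml.
apply: le_trans (mindist_le _ (mem_rank1_pts N0 Lv _)) _.
  by move=> j; have := x01 j; have := xv j; nra.
apply: enorm_le => [|j]; first by nra.
rewrite !mxE ler_norml; have := x01 j; have := xv j; nra.
Qed.

(** Differences of distinct points are nonzero lattice vectors. *)
Lemma sep_rad_ge : (exists x y, [/\ x \in P, y \in P & x != y]) ->
  lambda1 L / 2 <= sep_rad P.
Proof.
move=> [x [y [xP yP xy]]]; rewrite ler_pM2r ?invr_gt0 //.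
apply: lb_le_inf; first by exists (edist x y), x, y.
move=> _ [{xP yP xy}x [{}y [/rank1_ptsP[n _ ->] /rank1_ptsP[n' _ ->] xy ->]]].
apply: lambda1_le; last by rewrite subr_eq0.
by apply: rank1_latticeB; apply: rank1_pt_lattice.
Qed.

End MeshRatio.

(** * Mesh ratio of Korobov point sets *)

Section Korobov.
Variables (R : realType) (d N a : nat).
Hypothesis N1 : (1 < N)%N.
Local Notation P := (@korobov_pts R d.+1 N a).

Lemma korobov_z0 : korobov_z N a (ord0 : 'I_d.+1) = 1%N.
Proof. by rewrite /korobov_z expn0 modn_small. Qed.

Lemma card_korobov_pts : card_pts P = N.
Proof.
rewrite /card_pts undup_id ?size_map ?size_iota //.
rewrite map_inj_in_uniq ?iota_uniq // => n n'; rewrite !mem_iota /= => nN nN'.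
exact: (rank1_pt_inj korobov_z0 nN nN').
Qed.

Lemma korobov_pts_distinct : exists x y, [/\ x \in P, y \in P & x != y].
Proof.
exists (rank1_pt R N (korobov_z N a) 0), (rank1_pt R N (korobov_z N a) 1).
split; [by apply/rank1_ptsP; exists 0%N => //; lia | by apply/rank1_ptsP; exists 1%N |].
by apply/eqP => /(rank1_pt_inj korobov_z0 (ltnW N1) N1).
Qed.

(* With [r] the integer part of [N ^ (1 / d)], the hypothesis forces [lambda1 >= c / (d r)],
   so that vectors of size [1 / m ~ K / r] span once [K] is large. *)
Lemma mesh_ratio_korobov_le (c : R) (k0 : nat) :
  let D := d.+1 in let K := (k0 ^ d).+1 in
  0 < c -> (2 * D ^ 3)%:R < c * k0%:R ->
  ((8 * D * K) ^ D < N)%N ->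
  c <= lambda1 (@korobov_lattice R D N a) * lambda1 (dual_lattice (@korobov_lattice R D N a)) ->
  mesh_ratio P <= (12 * D ^ 3 * K)%:R / c.
Proof.
move=> D K c0 ck0 hN hc.
have N0 : (0 < N)%N by apply: ltnW.
have [||r [rlo rhi]] := @exists_last_le N (fun r => r ^ D)%N.
- by rewrite exp0n.
- by move=> r; case: r => // r; rewrite -[X in (X <= _)%N]expn1 leq_pexp2l.
set l := lambda1 _ in hc; have l0 : 0 <= l := lambda1_ge0 _.
have hl : c <= l * (D * r)%:R.
  by apply: le_trans hc _; rewrite ler_wpM2l // lambda1_dual_le.
have K0 : (0 < K)%N by [].
(* This yields [m >= 8 D], so that [e = D / m] satisfies [4 * e <= 1] below. *)
have rK : (8 * D * K <= r)%N.
  have := ltn_trans hN rhi; rewrite ltn_exp2r //; lia.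
pose m := (r %/ K)%N.
have m8 : (8 * D <= m)%N by rewrite leq_divRL.
have m0 : (0 < m)%N by apply: leq_trans m8.
have mr : (m * K <= r)%N by rewrite leq_divM.
have rm : (r <= 2 * (m * K))%N.
  have := ltn_ceil r K0; rewrite -/m; nia.
have k00 : (0 < k0)%N.
  by case: k0 ck0 {hN rK m m8 m0 mr rm K K0} => //; rewrite mulr0 ltNge ler0n.
pose k := (K * k0)%N; have k_gt0 : (0 < k)%N by rewrite muln_gt0 K0.
have mR : 0 < m%:R :> R by rewrite ltr0n.
have KR : 0 < K%:R :> R by rewrite ltr0n.
have DR : 0 < D%:R :> R by rewrite ltr0n.
have hl' : c <= l * (2 * D%:R * m%:R * K%:R).
  apply: le_trans hl _; rewrite ler_wpM2l // -!natrM ler_nat.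
  by rewrite -!mulnA mulnCA leq_mul2l /= mulnA -mulnA; lia.
have span (u : 'cV[R]_D) : u != 0 ->
     exists2 v, @korobov_lattice R D N a v /\ (forall j, `|v 0 j| <= m%:R^-1) & v *m u != 0.
  apply: (@short_vectors_span R d N m k) => //; first exact: korobov_z0.
    (* Since [k0 ^ d < K], the number of cells [m (m K k0)^d] is below [(m K)^D <= r^D <= N]. *)
    apply: leq_trans rlo; apply: leq_trans (_ : ((m * K) ^ D <= _)%N); last by rewrite leq_exp2r.
    rewrite /k mulnA [((m * K * k0) ^ d)%N]expnMn expnS.
    have X0 : (0 < (m * K) ^ d)%N by rewrite expn_gt0 muln_gt0 m0.
    rewrite (mulnC ((m * K) ^ d)%N) mulnA ltn_pmul2r // ltn_pmul2l //.
  (* After scaling by [2 D], the claim follows from [2 D^3 < c k0 <= 2 D l m k]. *)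
  rewrite ltr_pdivrMr ?ltr0n ?muln_gt0 ?m0 // -(ltr_pM2l (mulr_gt0 (ltr0Sn R 1) DR)).
  rewrite (_ : 2 * D%:R * (D * D)%:R = (2 * D ^ 3)%:R); last by rewrite !natrM; ring.
  apply: lt_le_trans ck0 _.
  apply: le_trans (ler_wpM2r (ler0n R k0) hl') _.
  by rewrite le_eqVlt; apply/orP; left; apply/eqP; rewrite /k !natrM; ring.
have lpos : 0 < l.
  by rewrite lt_neqAle l0 andbT; apply: contraTneq hl' => <-; rewrite mul0r -ltNge.
have fill : fill_dist P <= D%:R * (3 * (D%:R * m%:R^-1)).
  apply: (@fill_dist_le R D N (korobov_z N a) N0 (D%:R / m%:R)); last first.
  - exact: rank1_lattice_covering span.
  - by rewrite mulrA ler_pdivrMr // mul1r -natrM ler_nat; lia.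
  by rewrite divr_gt0.
have sep := @sep_rad_ge R D N (korobov_z N a) korobov_pts_distinct.
have spos : 0 < sep_rad P by apply: lt_le_trans sep; rewrite divr_gt0.
rewrite /mesh_ratio ler_pdivrMr //.
apply: le_trans fill _; apply: le_trans (ler_wpM2l _ sep); last by rewrite divr_ge0 // ltW.
rewrite -/l.
(* The fill distance is at most [3 D^2 / m], and [1 / m <= 2 D K l / c] by [hl']; dividing by
   [l / 2] gives the constant. *)
have -> : (12 * D ^ 3 * K)%:R / c * (l / 2) = 3 * D%:R ^+ 2 * (l * (2 * D%:R * K%:R)) / c.
  by rewrite !natrM; field; rewrite lt0r_neq0.
have -> : D%:R * (3 * (D%:R / m%:R)) = 3 * D%:R ^+ 2 * m%:R^-1 :> R by ring.
rewrite -[leRHS]mulrA ler_pM2l ?mulr_gt0 ?exprn_gt0 // ler_pdivlMr // mulrC ler_pdivrMr //.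
by apply: le_trans hl' _; rewrite le_eqVlt; apply/orP; left; apply/eqP; ring.
Qed.

End Korobov.

(** * Quasi-uniformity of the maximizing family *)

Theorem mainTheorem8 (R : realType) (d : nat) (hd : (1 <= d)%N) (a : nat -> nat) :
  (forall i, (1 <= a i <= (nth_prime i).-1)%N /\
     (forall b, (1 <= b <= (nth_prime i).-1)%N ->
        lambda1 (@korobov_lattice R d (nth_prime i) b)
          * lambda1 (dual_lattice (@korobov_lattice R d (nth_prime i) b))
        <= lambda1 (@korobov_lattice R d (nth_prime i) (a i))
          * lambda1 (dual_lattice (@korobov_lattice R d (nth_prime i) (a i))))) ->
  quasi_uniform (fun i => @korobov_pts R d (nth_prime i) (a i)).
Proof.
move=> maxa; case: d hd maxa => // d _ maxa.
have N1 i := prime_gt1 (nth_prime_prime i).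
split; first by move=> i; rewrite card_korobov_pts.
split.
  (* The sum covers the primes below 400, whose indices are below 400. *)
  pose C := (8 + \sum_(i < 400) nth_prime i.+1)%N.
  exists C%:R; split=> [|i]; first by rewrite ltr1n.
  rewrite !card_korobov_pts ?N1 // nth_prime_ltS; split => //.
  rewrite -natrM ler_nat; have [h|h] := leqP 400 (nth_prime i).
    by apply: leq_trans (next_prime_le h) _; rewrite leq_mul2r leq_addr orbT.
  have i400 : (i < 400)%N by have := nth_prime_gt i; lia.
  apply: leq_trans (leq_pmulr _ (ltnW (N1 i))).
  by rewrite /C (bigD1 (Ordinal i400)) //= addnCA leq_addr.
set D := d.+1.
pose c : R := (4 * D * D * 5 ^ D)%:R^-1.
have c0 : 0 < c by rewrite invr_gt0 ltr0n !muln_gt0 expn_gt0.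
pose k0 := (Num.truncn ((2 * D ^ 3)%:R / c)).+1.
have ck0 : (2 * D ^ 3)%:R < c * k0%:R.
  by rewrite mulrC -ltr_pdivrMr // truncnS_gt.
(* As the prime of index [i] exceeds [i], both size thresholds hold from [i0] on. *)
pose i0 := ((8 * D * (k0 ^ d).+1) ^ D + (D * 3 ^ D + 1))%N.
have big i : (i0 <= i)%N -> mesh_ratio (@korobov_pts R D (nth_prime i) (a i)) <=
    (12 * D ^ 3 * (k0 ^ d).+1)%:R / c.
  move=> hi; have hN : (i0 < nth_prime i)%N by apply: leq_ltn_trans hi (ltnW (nth_prime_gt i)).
  apply: mesh_ratio_korobov_le => //; first by apply: leq_ltn_trans hN; rewrite leq_addr.
  have [|b [hb cb]] := @exists_good_korobov R D _ isT (nth_prime_prime i).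
    by apply: leq_ltn_trans hN; rewrite leq_addl.
  (* The maximizer inherits the bound of the good parameter [b]. *)
  by apply: le_trans cb _; apply: (maxa i).2.
pose f i := mesh_ratio (@korobov_pts R D (nth_prime i) (a i)).
exists ((12 * D ^ 3 * (k0 ^ d).+1)%:R / c + \sum_(i < i0) `|f i|) => i.
have [/big h|h] := leqP i0 i.
  by apply: le_trans h _; rewrite lerDl sumr_ge0.
rewrite (bigD1 (Ordinal h)) //= -/(f i) addrCA.
apply: le_trans (ler_norm _) _; rewrite lerDl addr_ge0 ?sumr_ge0 //.
by rewrite divr_ge0 // ltW.
Qed.
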